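(* Let $l^{(1)}(t)$ and $u^{(1)}(t)$ be functions (values $\pm\infty$ allowed) such that $l^{(1)}(t)\le m^{(1)}_{\lambda}(t)\le u^{(1)}(t)$ for all $\lambda\ge 0$ and any $t$. Suppose that $P_{\boldsymbol\theta}[l^{(1)}(D)\le m_{0,1}\le u^{(1)}(D)]<1$ for all $\boldsymbol\theta\in\Theta_0$. Define, for each $t$, $\xi^{*}(t)=\max\{l^{(1)}(t),\min\{m_{0,1},u^{(1)}(t)\}\}$. Then, under the GPN criterion with a general loss function, the estimator $\delta_{\xi^{*}}(\mathbf{X})=X_1-\xi^{*}(D)$ is Pitman nearer to $\theta_1$ over $\Theta_0$ than the unrestricted Pitman nearest location equivariant estimator $\delta_{1,PNLEE}(\mathbf{X})=X_1-m_{0,1}$.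
   Context: $f$ is a specified Lebesgue probability density on $\mathbb{R}^2$, and $\mathbf{X}=(X_1,X_2)$ has joint p.d.f. $f(x_1-\theta_1,x_2-\theta_2)$, where $\boldsymbol\theta=(\theta_1,\theta_2)\in\Theta_0=\{(t_1,t_2)\in\mathbb{R}^2: t_1\le t_2\}$ is unknown. Put $\lambda=\theta_2-\theta_1\ge 0$, $D=X_2-X_1$, $Z_1=X_1-\theta_1$; $m_{0,1}$ is the median of $Z_1$. The p.d.f. of $D$ is $f_D(t|\lambda)=\int_{-\infty}^{\infty}f(y,y+t-\lambda)\,dy$, and the conditional p.d.f. of $Z_1$ given $D=t$ is $f_\lambda(s|t)=f(s,s+t-\lambda)/f_D(t|\lambda)$ ($t$ in the support of $D$). $m^{(1)}_\lambda(t)$ denotes the median of this conditional distribution, so $\int_{-\infty}^{m^{(1)}_\lambda(t)}f(s,s+t-\lambda)\,ds=\frac12\int_{-\infty}^{\infty}f(s,s+t-\lambda)\,ds$. General loss function: $L_1(\boldsymbol\theta,a)=W(a-\theta_1)$, $a\in\mathbb{R}$, where $W:\mathbb{R}\to[0,\infty)$ satisfies $W(0)=0$, $W$ strictly decreasing on $(-\infty,0)$ and strictly increasing on $(0,\infty)$. GPN criterion: for estimators $\delta_1,\delta_2$ of $\theta_1$, $GPN(\delta_1,\delta_2;\boldsymbol\theta)=P_{\boldsymbol\theta}[L_1(\boldsymbol\theta,\delta_1)<L_1(\boldsymbol\theta,\delta_2)]+\frac12P_{\boldsymbol\theta}[L_1(\boldsymbol\theta,\delta_1)=L_1(\boldsymbol\theta,\delta_2)]$.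 $\delta_1$ is (Pitman) nearer to $\theta_1$ than $\delta_2$ if $GPN(\delta_1,\delta_2;\boldsymbol\theta)\ge\frac12$ for all $\boldsymbol\theta\in\Theta_0$, with strict inequality for some $\boldsymbol\theta\in\Theta_0$. All functions defining estimators are understood to be Borel measurable.
   Formalization: Added: W has equal finite one-sided limits at 0 (W(0) may differ); without this the strict inequality can fail. ''The median'' of the conditional law of Z_1 given D=t is taken to be unique. *)

(* Defs.v *)
From HB Require Import structures.
From mathcomp Require Export all_boot all_order all_algebra.
From mathcomp Require Export all_classical all_reals all_analysis.
From mathcomp Require Export measurable_realfun.

Set Implicit Arguments.
Unset Strict Implicit.
Unset Printing Implicit Defensive.

Import Order.TTheory GRing.Theory Num.Theory.
Export numFieldNormedType.Exports.

Local Open Scope classical_set_scope.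
Local Open Scope ring_scope.
Local Open Scope ereal_scope.

Section densities.
Context {R : realType}.
Local Notation mu := (@lebesgue_measure R).

Definition is_pdf2 (f : R * R -> R) : Prop :=
  [/\ measurable_fun [set: R * R] f,
      forall x, (0 <= f x)%R &
      \int[mu \x mu]_x (f x)%:E = 1].

(* The median of an absolutely continuous law, in terms of its density g,
   which may take the value +oo on a null set. *)
Definition is_median (g : R -> \bar R) (m : R) : Prop :=
  \int[mu]_(s in `]-oo, m]) g s = (2^-1)%:E.

Definition pdf_Z1 (f : R * R -> R) (s : R) : \bar R :=
  \int[mu]_y (f (s, y))%:E.

Definition pdf_D (f : R * R -> R) (lambda t : R) : \bar R :=
  \int[mu]_y (f (y, y + t - lambda)%R)%:E.

(* A density is only determined up to a null set, so the support of D is the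
   set of points at which the conditional density below makes sense. *)
Definition support_D (f : R * R -> R) (lambda : R) : set R :=
  [set t | 0 < pdf_D f lambda t < +oo].

Definition cond_pdf_Z1 (f : R * R -> R) (lambda t s : R) : \bar R :=
  (f (s, s + t - lambda) / fine (pdf_D f lambda t))%R%:E.

End densities.

Section estimation.
Context {R : realType}.

Definition Theta0 : set (R * R) := [set theta | (theta.1 <= theta.2)%R].

Definition has_location_density d (Omega : measurableType d)
    (P : R * R -> probability Omega R) (X : Omega -> R * R)
    (f : R * R -> R) : Prop :=
  forall theta, Theta0 theta -> forall A, measurable A ->
    P theta (X @^-1` A) =
    \int[@lebesgue_measure R \x @lebesgue_measure R]_(x in A)
      (f (x.1 - theta.1, x.2 - theta.2)%R)%:E.

Definition is_general_loss (W : R -> R) : Prop :=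
  [/\ forall x, (0 <= W x)%R,
      W 0%R = 0%R,
      forall x y, (x < y)%R -> (y < 0)%R -> (W y < W x)%R &
      forall x y, (0 < x)%R -> (x < y)%R -> (W x < W y)%R].

Definition loss1 (W : R -> R) (theta : R * R) (a : R) : R :=
  W (a - theta.1)%R.

Definition GPN d (Omega : measurableType d) (P : R * R -> probability Omega R)
    (X : Omega -> R * R) (W : R -> R) (delta1 delta2 : R * R -> R)
    (theta : R * R) : \bar R :=
  P theta [set w | (loss1 W theta (delta1 (X w)) <
                    loss1 W theta (delta2 (X w)))%R] +
  (2^-1)%:E * P theta [set w | loss1 W theta (delta1 (X w)) =
                               loss1 W theta (delta2 (X w))].

Definition pitman_nearer d (Omega : measurableType d)
    (P : R * R -> probability Omega R) (X : Omega -> R * R) (W : R -> R)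
    (delta1 delta2 : R * R -> R) : Prop :=
  (forall theta, Theta0 theta -> (2^-1)%:E <= GPN P X W delta1 delta2 theta) /\
  (exists2 theta, Theta0 theta & (2^-1)%:E < GPN P X W delta1 delta2 theta).

Definition diff12 (x : R * R) : R := (x.2 - x.1)%R.

Definition xi_star (l u : R -> \bar R) (m01 : R) (t : R) : \bar R :=
  maxe (l t) (mine m01%:E (u t)).

(* xi_star is finite wherever l <= m <= u for some real m, hence at almost
   every value of D; [fine] only makes the estimator total. *)
Definition delta_xi (xi : R -> \bar R) (x : R * R) : R :=
  (x.1 - fine (xi (diff12 x)))%R.

Definition delta_PNLEE (m01 : R) (x : R * R) : R := (x.1 - m01)%R.

End estimation.

(* Main.v *)
(* In the coordinates [t = X2 - X1], [s = X1 - theta1] the law of [X] has density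
   [f (s, s + t - lambda)].  Fix [t].  If [l t <= m01 <= u t], the two estimators
   coincide.  If [m01 < l t], then [xi* t = l t] lies between [m01] and the
   conditional median, and the new estimator has strictly smaller loss as soon as
   [s > xi* t - e], for some [e > 0]; since the conditional median is unique this
   event has conditional probability more than 1/2.  The case [u t < m01] is the
   mirror image.  Integrating over [t] gives GPN >= 1/2, with equality only if
   [l D <= m01 <= u D] almost surely. *)
Require Import Defs.
From HB Require Import structures.
From mathcomp Require Import lra.

Set Implicit Arguments.
Unset Strict Implicit.
Unset Printing Implicit Defensive.

Import Order.TTheory GRing.Theory Num.Theory.
Local Open Scope classical_set_scope.
Local Open Scope ring_scope.
Local Open Scope ereal_scope.

(** * Translation invariance, difference coordinates, and equality from integrals *)

Lemma lebesgue_measure_shift (R : realType) (c : R) (A : set R) :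
  measurable A ->
  pushforward (@lebesgue_measure R)
    ((fun x : R => x + c)%R : _ -> measurableTypeR R) A =
  lebesgue_measure A.
Proof.
move=> mA; apply/esym.
have mc : measurable_fun [set: measurableTypeR R]
    ((fun x => x + c)%R : measurableTypeR R -> measurableTypeR R).
  exact: measurable_funD.
pose mshift := isMeasurableFun.Build _ _ _ _ _ mc.
pose shift_pack : {mfun measurableTypeR R >-> measurableTypeR R} :=
  HB.pack (fun x : R => x + c)%R mshift.
(* Lebesgue measure is determined by its values on the intervals []a, b]], whose length a
   translation preserves. *)
have := lebesgue_measure_unique
  (mu := pushforward (@lebesgue_measure R) shift_pack).
apply => //= _ [[a b]] _ <-.
rewrite /pushforward /=.
have -> : (fun x : R => x + c)%R @^-1` `]a, b] =
    `](a - c)%R, (b - c)%R]%classic.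
  by apply/seteqP; split => x /=; rewrite !in_itv/= ltrBlDr lerBrDr.
by rewrite !lebesgue_measure_itv/= !lte_fin ltrD2r -!EFinB opprB addrA subrK.
Qed.

Lemma ge0_integral_shift (R : realType) (c : R) (g : R -> \bar R) :
  measurable_fun [set: R] g -> (forall x, 0 <= g x) ->
  \int[@lebesgue_measure R]_x g (x + c)%R = \int[@lebesgue_measure R]_x g x.
Proof.
move=> mg g0.
have mc : measurable_fun [set: measurableTypeR R]
    ((fun x => x + c)%R : measurableTypeR R -> measurableTypeR R).
  exact: measurable_funD.
transitivity (\int[pushforward (@lebesgue_measure R)
    ((fun x : R => x + c)%R : _ -> measurableTypeR R)]_y g y).
  by rewrite ge0_integral_pushforward.
by apply: eq_measure_integral => A mA _; exact: lebesgue_measure_shift.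
Qed.

(** Tonelli and two translations: the inner variable is shifted by the outer one, the order of
    integration is swapped, and the outer variable is then shifted by [c]. With [c = theta.1] the
    new variables are [s = x.1 - theta.1] and [t = x.2 - x.1]. *)
Lemma ge0_integral_difference_coordinate (R : realType) (g : R * R -> \bar R)
    (c : R) : measurable_fun [set: R * R] g -> (forall x, 0 <= g x) ->
  \int[@lebesgue_measure R \x @lebesgue_measure R]_x g x =
  \int[@lebesgue_measure R]_t \int[@lebesgue_measure R]_s
    g (s + c, s + c + t)%R.
Proof.
move=> mg g0; rewrite fubini_tonelli1//.
transitivity (\int[@lebesgue_measure R]_x \int[@lebesgue_measure R]_t
    g (x, t + x)%R).
  apply: eq_integral => x _.
  rewrite (@ge0_integral_shift _ x (fun y => g (x, y)))//.
  exact: measurableT_comp.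
have mg' : measurable_fun setT (fun p : R * R => g (p.1, p.2 + p.1)%R).
  apply: measurableT_comp => //; apply: measurable_fun_pair => //.
  exact: measurable_funD.
have /= -> // := fubini_tonelli (m1 := @lebesgue_measure R)
  (m2 := @lebesgue_measure R) _ mg'.
apply: eq_integral => t _.
rewrite -(@ge0_integral_shift _ c (fun x => g (x, t + x)%R))//.
  by apply: eq_integral => s _; rewrite [(t + _)%R]addrC.
apply: measurableT_comp => //; apply: measurable_fun_pair => //.
exact: measurable_funD.
Qed.

(** The equality case of monotonicity: the excess of [h] over [g] has integral zero. Only [g] has a
    finite integral by hypothesis, so [h] may a priori be infinite. *)
Lemma ge0_ae_le_integral_eq d (T : measurableType d) (R : realType)
    (mu : {measure set T -> \bar R}) (g h : T -> \bar R) :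
  measurable_fun [set: T] g -> measurable_fun [set: T] h ->
  (forall x, 0 <= g x) -> (forall x, 0 <= h x) ->
  {ae mu, forall x, g x <= h x} ->
  \int[mu]_x g x < +oo -> \int[mu]_x h x <= \int[mu]_x g x ->
  {ae mu, forall x, g x = h x}.
Proof.
move=> mg mh g0 h0 gh gfin hg.
have ig : mu.-integrable setT g.
  by apply/integrableP; split => //; under eq_integral do rewrite gee0_abs//.
have fg := integrable_ae measurableT ig.
(* The positive part is nonnegative everywhere, whereas [h - g] is so only almost everywhere. *)
pose r := (h \- g)^\+.
have mr : measurable_fun setT r.
  by apply: measurable_funepos; exact: emeasurable_funB.
have r0 x : 0 <= r x by rewrite funepos_ge0.
have hgr : ae_eq mu setT h (g \+ r).
  apply: filterS2 gh fg => x ghx /(_ I) gx _.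
  rewrite /r /= funeposE max_l ?sube_ge0 ?ghx ?gx ?orbT//.
  by rewrite addeC subeK.
have : \int[mu]_x r x = 0.
  apply/eqP; rewrite eq_le integral_ge0 ?andbT//.
  move: hg; rewrite (ge0_ae_eq_integral _ _ _ _ _ hgr)//; last 2 first.
  - exact: emeasurable_funD.
  - by move=> x _; rewrite adde_ge0.
  (* The integral of [g] is finite, hence can be cancelled on both sides. *)
  rewrite ge0_integralD// -[leRHS]adde0 leeD2lE//.
  by rewrite ge0_fin_numE// integral_ge0.
move=> ir0; have : \int[mu]_x `|r x| = 0.
  by under eq_integral do rewrite gee0_abs//.
move=> /(ae_eq_integral_abs mu measurableT mr) rz.
apply: filterS2 hgr rz => x /(_ I) -> /(_ I) /= ->.
by rewrite adde0.
Qed.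

(** * Comparing losses around the target *)

Section loss.
Context {R : realType} (W : R -> R).

Lemma is_general_loss_opp : is_general_loss W -> is_general_loss (W \o -%R).
Proof.
case=> W0 W00 Wl Wr; split => [x|/=|x y xy y0|x y x0 xy] /=.
- exact: W0.
- by rewrite oppr0.
- by apply: Wr; rewrite ?ltrN2 ?oppr_gt0.
- by apply: Wl; rewrite ?ltrN2 ?oppr_lt0.
Qed.

(** Cut at [0] and extended by zero, [W] gives two monotone functions: nonnegativity keeps each of
    them monotone across [0], and [W 0 = 0] makes their sum correct there. *)
Lemma general_loss_measurable : is_general_loss W ->
  measurable_fun [set: R] W.
Proof.
case=> W0 W00 Wl Wr.
have -> : W = (fun x => (if 0 < x then W x else 0) +
    (if x < 0 then W x else 0))%R.
  apply/funext => x; case: (ltgtP x 0%R) => [_|_|->].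
  - by rewrite add0r.
  - by rewrite addr0.
  - by rewrite addr0.
apply: measurable_funD.
- apply: nondecreasing_measurable => // x y xy.
  case: ltP => x0; case: ltP => y0 //; last first.
    by have := lt_le_trans x0 xy; rewrite ltNge y0.
  by move: xy; rewrite le_eqVlt => /predU1P[->//|xy]; exact/ltW/Wr.
- apply: nonincreasing_measurable => // x y xy.
  case: (ltP y 0%R) => y0; case: (ltP x 0%R) => x0 //; last first.
    by have := le_lt_trans xy y0; rewrite ltNge x0.
  by move: xy; rewrite le_eqVlt => /predU1P[->//|xy]; exact/ltW/Wl.
Qed.

(* [W] may jump at [0]; the common limit [c] is what prevents a one-sided limit
   at [0] from exceeding values taken by [W] on the other side. *)
Lemma general_loss_lt_near0 (c b : R) : is_general_loss W ->
  W x @[x --> (0 : R)%R^'] --> c -> b != 0%R ->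
  exists2 e : R, (0 < e)%R & forall x, (`|x| < e)%R -> (W x < W b)%R.
Proof.
move=> [W0 W00 Wl Wr] Wc b0.
have b2 : (b / 2 != 0)%R by rewrite mulf_neq0// invr_neq0.
have Wb2 : (W (b / 2) < W b)%R.
  have [bp|bn] := ltP 0%R b.
    by apply: Wr; lra.
  by apply: Wl; move/eqP : b0; lra.
have cb : (c <= W (b / 2))%R.
  have [bp|bn] := ltP 0%R b.
    apply: (cvgr_to_le (cvg_dnbhs_at_right Wc)); near=> x.
    by apply/ltW/Wr => //; near: x; apply: nbhs_right_lt; lra.
  have {}bn : (b < 0)%R by rewrite lt_neqAle b0.
  apply: (cvgr_to_le (cvg_dnbhs_at_left Wc)); near=> x.
  by apply/ltW/Wl => //; near: x; apply: nbhs_left_gt; lra.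
have Wbc : (c < W b)%R by exact: le_lt_trans Wb2.
have : \forall x \near (0 : R)%R^', (W x < W b)%R by exact: cvgr_lt Wbc.
rewrite /dnbhs /within /= => /nbhs_ballP[e/= e0 We]; exists e => // x xe.
have [->|x0] := eqVneq x 0%R; first by rewrite W00 (le_lt_trans (W0 (b / 2)%R)).
by apply: We => //; rewrite /ball /= sub0r normrN.
Unshelve. all: by end_near.
Qed.

(** Beyond [a] this is monotonicity of [W]. The margin [e] is what matters later: it enlarges the
    favourable half-line so that it reaches strictly past a median. *)
Lemma general_loss_right (a m : R) : is_general_loss W ->
  (forall b : R, b != 0%R ->
    exists2 e : R, (0 < e)%R & forall x, (`|x| < e)%R -> (W x < W b)%R) ->
  (m < a)%R ->
  exists2 e : R, (0 < e)%R &
    forall z, (a - e < z)%R -> (W (z - a) < W (z - m))%R.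
Proof.
move=> [_ W00 _ Wr] Wnear ma.
have b0 : ((a - m) / 2 != 0)%R by lra.
have [e e0 We] := Wnear _ b0.
(* The first bound gives [W (z - a) < W ((a - m) / 2)] for [z] just below [a]; the second keeps
   [z - m] above [(a - m) / 2]. *)
exists (Order.min e ((a - m) / 2))%R; first by rewrite lt_min e0/=; lra.
move=> z; rewrite ltrBlDr -ltrBlDl lt_min => /andP[ze zm].
have [za|za] := ltP z a.
  have h1 : (W (z - a) < W ((a - m) / 2))%R.
    by apply: We; rewrite ltr0_norm; lra.
  by apply: (lt_trans h1); apply: Wr; lra.
have [->|za'] := eqVneq z a.
  (* Monotonicity on the open half-line says nothing about [W 0], so the bound near [0] is used
     first. *)
  rewrite subrr; apply: (lt_trans (y := W ((a - m) / 2)%R)).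
    by apply/We; rewrite normr0.
  by apply: Wr; lra.
by apply: Wr; move/eqP : za'; lra.
Qed.

End loss.

(** Reflection of [general_loss_right], for the loss [W \o -%R] and the points [- a] and [- m]. *)
Lemma general_loss_left (R : realType) (W : R -> R) (a m : R) :
  is_general_loss W ->
  (forall b : R, b != 0%R ->
    exists2 e : R, (0 < e)%R & forall x, (`|x| < e)%R -> (W x < W b)%R) ->
  (a < m)%R ->
  exists2 e : R, (0 < e)%R &
    forall z, (z < a + e)%R -> (W (z - a) < W (z - m))%R.
Proof.
move=> hW Wnear am.
have Wnear' (b : R) : b != 0%R -> exists2 e : R, (0 < e)%R &
    forall x, (`|x| < e)%R -> ((W \o -%R) x < (W \o -%R) b)%R.
  rewrite -oppr_eq0 => /Wnear[e e0 We]; exists e => // x xe.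
  by apply: We; rewrite normrN.
have := general_loss_right (a := (- a)%R) (m := (- m)%R)
  (is_general_loss_opp hW) Wnear'.
rewrite ltrN2 => /(_ am)[e e0 We]; exists e => // z za.
have := We (- z)%R; rewrite /= -!opprD !opprK; apply; lra.
Qed.

(** * The law of the observation along lines of constant difference *)

Section law.
Context {R : realType} (f : R * R -> R) (hf : is_pdf2 f).
Local Notation mu := (@lebesgue_measure R).

Lemma measurable_density_line (lambda t : R) :
  measurable_fun [set: R] (fun s => (f (s, s + t - lambda)%R)%:E).
Proof.
have [mf _ _] := hf.
apply/measurable_EFinP; apply: measurableT_comp => //.
apply: measurable_fun_pair => //; apply: measurable_funB => //.
exact: measurable_funD.
Qed.

(** The conditional probability that [Z1] lies in [A] given [D = t], multiplied by the density of
    [D] at [t]. Leaving it unnormalised gives it a meaning for every [t], also off the support. *)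
Definition density_on (lambda t : R) (A : set R) : \bar R :=
  \int[mu]_(s in A) (f (s, s + t - lambda)%R)%:E.

Lemma density_on_ge0 lambda t A : 0 <= density_on lambda t A.
Proof. by have [_ f0 _] := hf; apply: integral_ge0 => s _; rewrite lee_fin. Qed.

Lemma density_on_subset lambda t A B : measurable A -> measurable B ->
  A `<=` B -> density_on lambda t A <= density_on lambda t B.
Proof.
have [_ f0 _] := hf.
move=> mA mB AB; apply: ge0_subset_integral => //.
- by apply: measurable_funTS; exact: measurable_density_line.
- by move=> s _; rewrite lee_fin.
Qed.

(** The section of [A] at [x.2 - x.1 = t], parametrised by [s = x.1 - theta.1]. *)
Definition difference_slice (theta : R * R) (A : set (R * R)) (t : R) : set R :=
  [set s | A (s + theta.1, s + theta.1 + t)%R].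

Section slices.
Context (theta : R * R) (A : set (R * R)) (mA : measurable A).

(** Here [p.1] is [t] and [p.2] is [s]; joint measurability lets Tonelli give measurability in [t]
    of the slice masses. *)
Let mg : measurable_fun [set: R * R] (fun p : R * R =>
  ((f (p.2, p.2 + p.1 - (theta.2 - theta.1)))%R *
    \1_A (p.2 + theta.1, p.2 + theta.1 + p.1))%R%:E).
Proof.
have [mf _ _] := hf.
have m2 : measurable_fun [set: R * R] (fun p : R * R => p.2 + theta.1)%R.
  exact: measurable_funD.
apply/measurable_EFinP; apply: measurable_funM.
  apply: measurableT_comp => //; apply: measurable_fun_pair => //.
  apply: measurable_funB => //; exact: measurable_funD.
have mI : measurable_fun [set: R * R] (\1_A : R * R -> R).
  exact: measurable_indic.
apply: (measurableT_comp mI).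
apply: measurable_fun_pair => //; exact: measurable_funD.
Qed.

Lemma measurable_difference_slice t :
  measurable (difference_slice theta A t).
Proof.
rewrite -[difference_slice _ _ t]setTI.
apply: (_ : measurable_fun setT
  (fun s : R => (s + theta.1, s + theta.1 + t)%R)) => //.
have m2 : measurable_fun [set: R] (fun s : R => s + theta.1)%R.
  exact: measurable_funD.
apply: measurable_fun_pair => //; exact: measurable_funD.
Qed.

Let densityE t : density_on (theta.2 - theta.1) t (difference_slice theta A t) =
  \int[mu]_s ((f (s, s + t - (theta.2 - theta.1)))%R *
    \1_A (s + theta.1, s + theta.1 + t))%R%:E.
Proof.
rewrite /density_on integral_mkcond; apply: eq_integral => s _.
rewrite patchE indicE /difference_slice.
have -> : (s \in [set s | A (s + theta.1, s + theta.1 + t)%R]) =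
    ((s + theta.1, s + theta.1 + t)%R \in A).
  by apply/idP/idP; rewrite !inE.
by case: (_ \in A); rewrite ?mulr1 ?mulr0.
Qed.

Lemma measurable_density_slice :
  measurable_fun [set: R] (fun t =>
    density_on (theta.2 - theta.1) t (difference_slice theta A t)).
Proof.
have [_ f0 _] := hf.
under eq_fun do rewrite densityE.
apply: (measurable_fun_fubini_tonelli_F (m2 := mu) _ mg) => p.
by rewrite lee_fin mulr_ge0.
Qed.

(** Disintegration along [D]: the passage to [(s, t)] preserves area, and in these coordinates the
    density depends on [theta] only through [theta.2 - theta.1]. *)
Lemma location_density_slices d (Omega : measurableType d)
    (P : R * R -> probability Omega R) (X : Omega -> R * R) :
  has_location_density P X f -> Theta0 theta ->
  P theta (X @^-1` A) =
  \int[mu]_t density_on (theta.2 - theta.1) t (difference_slice theta A t).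
Proof.
have [mf f0 _] := hf.
move=> hXf htheta; rewrite hXf// integral_mkcond.
pose g (x : R * R) := ((f (x.1 - theta.1, x.2 - theta.2)%R) * \1_A x)%R%:E.
transitivity (\int[mu \x mu]_x g x).
  apply: eq_integral => x _; rewrite patchE /g indicE.
  by case: (_ \in A); rewrite ?mulr1 ?mulr0.
rewrite (ge0_integral_difference_coordinate theta.1); last 2 first.
- apply/measurable_EFinP; apply: measurable_funM => //.
  apply: measurableT_comp => //.
  apply: measurable_fun_pair => //; exact: measurable_funB.
- by move=> x; rewrite lee_fin mulr_ge0.
apply: eq_integral => t _; rewrite densityE; apply: eq_integral => s _.
rewrite /g /= addrK; congr (f (_, _) * _)%:E%R; lra.
Qed.

End slices.

Lemma density_on_setT lambda t : density_on lambda t setT = pdf_D f lambda t.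
Proof. by []. Qed.

(** Derived from the total mass of [f] alone: the difference coordinates with [c = 0], then a
    translation of the second variable by [lambda]. *)
Lemma integral_pdf_D_eq1 lambda : \int[mu]_t pdf_D f lambda t = 1.
Proof.
have [mf f0 f1] := hf.
pose g (x : R * R) := (f (x.1, x.2 - lambda)%R)%:E.
have mg : measurable_fun setT g.
  apply/measurable_EFinP; apply: measurableT_comp => //.
  apply: measurable_fun_pair => //; exact: measurable_funB.
transitivity (\int[mu \x mu]_x g x).
  rewrite (ge0_integral_difference_coordinate 0%R)//; last first.
    by move=> x; rewrite lee_fin.
  by apply: eq_integral => t _; apply: eq_integral => s _; rewrite /g /= addr0.
rewrite fubini_tonelli1//; last by move=> x; rewrite lee_fin.
rewrite -[RHS]f1 fubini_tonelli1//; last exact/measurable_EFinP.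
apply: eq_integral => x _.
rewrite /fubini_F /g /=.
rewrite (@ge0_integral_shift _ (- lambda)%R (fun y => (f (x, y))%:E))//.
- apply/measurable_EFinP; exact: measurableT_comp.
- by move=> y; rewrite lee_fin.
Qed.

(** * Strict inequalities from uniqueness of the conditional median *)

Section conditional_median.
Context (lambda t m : R) (ht : support_D f lambda t)
  (hm : unique (is_median (cond_pdf_Z1 f lambda t)) m).

Let p_gt0 : (0 < fine (pdf_D f lambda t))%R.
Proof. exact: fine_gt0. Qed.

Let pE : (fine (pdf_D f lambda t))%:E = pdf_D f lambda t.
Proof. by case/andP: ht => p0 py; rewrite fineK// ge0_fin_numE// ltW. Qed.

(** On the support the normalising constant is positive and finite, so it can be cleared in both
    directions. *)
Lemma is_median_cond_pdf_Z1 a : is_median (cond_pdf_Z1 f lambda t) a <->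
  density_on lambda t `]-oo, a] = (2^-1)%:E * pdf_D f lambda t.
Proof.
have [_ f0 _] := hf.
have -> : density_on lambda t `]-oo, a] = pdf_D f lambda t *
    \int[mu]_(s in `]-oo, a]) cond_pdf_Z1 f lambda t s.
  rewrite -pE -ge0_integralZl//; last 3 first.
  - apply/measurable_EFinP; apply: measurable_funM => //.
    apply: measurable_funTS; apply/measurable_EFinP.
    exact: measurable_density_line.
  - by move=> s _; rewrite lee_fin divr_ge0// ltW.
  - by rewrite lee_fin ltW.
  by apply: eq_integral => s _; rewrite -EFinM mulrC divfK// gt_eqF.
rewrite /is_median muleC; split => [->//|]; rewrite -pE.
set p := fine _; set I := integral _ _ _ => Ip.
have -> : I = I * p%:E * (p^-1)%:E.
  by rewrite -muleA -EFinM divff ?mule1// gt_eqF.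
by rewrite Ip -!EFinM mulfK// gt_eqF.
Qed.

(** The mass of []-oo, a]] is at most half by monotonicity, and not exactly half because [a] would
    be a second median. The complement therefore has more than half. *)
Lemma density_on_gt_median_right a : (a < m)%R ->
  (2^-1)%:E * pdf_D f lambda t < density_on lambda t `]a, +oo[.
Proof.
have [_ f0 _] := hf; have [/is_median_cond_pdf_Z1 hmE hmu] := hm => am.
have lta : density_on lambda t `]-oo, a] < (2^-1)%:E * pdf_D f lambda t.
  rewrite lt_neqAle -{2}hmE density_on_subset//; last first.
    by apply: subset_itvl; rewrite bnd_simp ltW.
  rewrite andbT; apply/eqP => /is_median_cond_pdf_Z1 /hmu ma.
  by move: am; rewrite ma ltxx.
have := density_on_setT lambda t.
rewrite {1}/density_on -(setUv `]-oo, a]) setCitvl.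
rewrite ge0_integral_setU//=; last 3 first.
- by rewrite -setCitvl setUv; exact: measurable_density_line.
- by move=> s _; rewrite lee_fin.
- by apply/disj_setPS => s [] /=; rewrite !in_itv/= andbT leNgt => /negP.
rewrite -!/(density_on _ _ _) -pE.
(* Finite masses allow the complement to be computed by subtraction in the reals. *)
have fin A : measurable A -> density_on lambda t A \is a fin_num.
  move=> mA; rewrite ge0_fin_numE ?density_on_ge0//.
  case/andP: ht => _; apply: le_lt_trans.
  by rewrite -density_on_setT; exact: density_on_subset.
move: lta; rewrite -pE -(fineK (fin _ (measurable_itv `]-oo, a]))).
rewrite -(fineK (fin _ (measurable_itv `]a, +oo[))).
rewrite -!EFinM -EFinD !lte_fin => lta []; lra.
Qed.

Lemma density_on_gt_median_left a : (m < a)%R ->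
  (2^-1)%:E * pdf_D f lambda t < density_on lambda t `]-oo, a[.
Proof.
have [/is_median_cond_pdf_Z1 hmE hmu] := hm => ma.
(* The midpoint provides a closed half-line inside the open one that still passes [m], so uniqueness
   applies to it. *)
apply: (@lt_le_trans _ _ (density_on lambda t `]-oo, ((m + a) / 2)%R]));
  last first.
  by apply: density_on_subset => // s /=; rewrite !in_itv/=; lra.
rewrite lt_neqAle -{2}hmE density_on_subset//; last first.
  by apply: subset_itvl; rewrite bnd_simp; lra.
rewrite andbT; apply/eqP => /esym /is_median_cond_pdf_Z1 /hmu; lra.
Qed.

End conditional_median.

End law.

(** * Comparison of the two estimators, slice by slice and then integrated *)

Section comparison.
Context (R : realType) (f : R * R -> R) (W : R -> R) (m01 : R)
  (m1 : R -> R -> R) (l u : R -> \bar R)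
  (hf : is_pdf2 f) (hW : is_general_loss W)
  (hW0 : exists c : R, W x @[x --> (0 : R)%R^'] --> c)
  (hm1 : forall lambda t : R, (0 <= lambda)%R -> support_D f lambda t ->
     unique (is_median (cond_pdf_Z1 f lambda t)) (m1 lambda t))
  (hl : measurable_fun [set: R] l) (hu : measurable_fun [set: R] u)
  (hlu : forall lambda t : R, (0 <= lambda)%R -> support_D f lambda t ->
     l t <= (m1 lambda t)%:E <= u t).
Local Notation mu := (@lebesgue_measure R).
Local Notation delta1 := (delta_xi (xi_star l u m01)).
Local Notation delta2 := (delta_PNLEE m01).

Let better theta : set (R * R) :=
  [set x | (loss1 W theta (delta1 x) < loss1 W theta (delta2 x))%R].
Let tied theta : set (R * R) :=
  [set x | loss1 W theta (delta1 x) = loss1 W theta (delta2 x)].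

Let mdiff : measurable_fun [set: R * R] (@diff12 R).
Proof. exact: measurable_funB. Qed.

Let mdelta1 : measurable_fun [set: R * R] delta1.
Proof.
apply: measurable_funB => //.
apply: measurableT_comp; first exact: fine_measurable.
apply: measurable_maxe; first exact: measurableT_comp.
apply: measurable_mine => //; exact: measurableT_comp.
Qed.

Let mdelta2 : measurable_fun [set: R * R] delta2.
Proof. exact: measurable_funB. Qed.

Let mloss theta (delta : R * R -> R) : measurable_fun setT delta ->
  measurable_fun [set: R * R] (fun x => loss1 W theta (delta x)).
Proof.
move=> md; apply: (measurableT_comp (general_loss_measurable hW)).
exact: measurable_funB.
Qed.

Let mbetter theta : measurable (better theta).
Proof.
rewrite -[better _]setTI.
exact: (measurable_fun_ltr (mloss theta mdelta1) (mloss theta mdelta2)).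
Qed.

Let mtied theta : measurable (tied theta).
Proof.
rewrite (_ : tied theta = setT `&` (fun x => loss1 W theta (delta1 x) ==
    loss1 W theta (delta2 x)) @^-1` [set true]); last first.
  by apply/seteqP; split => x /= => [/eqP //|[_] /eqP].
exact: (measurable_fun_eqr (mloss theta mdelta1) (mloss theta mdelta2)).
Qed.

Let lossE1 (theta : R * R) s t :
  loss1 W theta (delta1 (s + theta.1, s + theta.1 + t)%R) =
  W (s - fine (xi_star l u m01 t))%R.
Proof.
rewrite /loss1 /delta_xi /diff12 /=; congr W.
have -> : (s + theta.1 + t - (s + theta.1))%R = t by rewrite addrC addKr.
by rewrite addrAC addrK.
Qed.

Let lossE2 (theta : R * R) s t :
  loss1 W theta (delta2 (s + theta.1, s + theta.1 + t)%R) = W (s - m01)%R.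
Proof. by rewrite /loss1 /delta_PNLEE /=; congr W; rewrite addrAC addrK. Qed.

Let tied_within theta t : l t <= m01%:E <= u t ->
  difference_slice theta (tied theta) t = setT.
Proof.
move=> /andP[lm mu_]; apply/seteqP; split => // s _.
rewrite /difference_slice /tied /= lossE1 lossE2.
by rewrite /xi_star min_l// max_r.
Qed.

Let better_outside theta t : (0 <= theta.2 - theta.1)%R ->
  support_D f (theta.2 - theta.1) t -> ~ (l t <= m01%:E <= u t) ->
  (2^-1)%:E * pdf_D f (theta.2 - theta.1) t <
  density_on f (theta.2 - theta.1) t (difference_slice theta (better theta) t).
Proof.
move=> th0 ht nlmu; have hm := hm1 th0 ht.
have /andP[lm mu_] := hlu th0 ht.
have [c Wc] := hW0.
have Wnear b := @general_loss_lt_near0 _ W c b hW Wc.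
have [ml|lm01] := ltP m01%:E (l t).
  have xiE : xi_star l u m01 t = l t.
    by rewrite /xi_star max_l// ge_min (ltW ml).
  (* [l t] is finite, being squeezed between [m01] and the conditional median. *)
  have ltE : (fine (l t))%:E = l t.
    rewrite fineK// fin_real// (lt_trans _ ml) ?ltNyr//.
    by rewrite (le_lt_trans lm)// ltry.
  have [|e e0 We] := @general_loss_right _ W (fine (l t)) m01 hW Wnear.
    by rewrite -lte_fin ltE.
  (* Since [l t] is at most the conditional median, [s > m1 - e] forces [s > l t - e], where the new
     loss is smaller. *)
  apply: (lt_le_trans (density_on_gt_median_right hf ht hm
    (a := (m1 (theta.2 - theta.1) t - e)%R) _)); first by rewrite ltrBlDr ltrDl.
  apply: density_on_subset => //; first exact: measurable_difference_slice.
  move=> s /=; rewrite in_itv/= andbT => ms.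
  rewrite /difference_slice /better /= lossE1 lossE2 xiE; apply: We.
  by apply: le_lt_trans ms; rewrite lerB// -lee_fin ltE.
have um : u t < m01%:E.
  by rewrite ltNge; apply/negP => mu'; apply: nlmu; rewrite lm01.
(* The outer maximum is [u t] because [l t <= u t], through the conditional median. *)
have xiE : xi_star l u m01 t = u t.
  by rewrite /xi_star min_r ?(ltW um)// max_r// (le_trans lm).
have utE : (fine (u t))%:E = u t.
  rewrite fineK// fin_real// (lt_trans um) ?ltry//.
  by rewrite (lt_le_trans _ mu_)// ltNyr.
have [|e e0 We] := @general_loss_left _ W (fine (u t)) m01 hW Wnear.
  by rewrite -lte_fin utE.
apply: (lt_le_trans (density_on_gt_median_left hf ht hm
  (a := (m1 (theta.2 - theta.1) t + e)%R) _)); first by rewrite ltrDl.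
apply: density_on_subset => //; first exact: measurable_difference_slice.
move=> s /=; rewrite in_itv/= => ms.
rewrite /difference_slice /better /= lossE1 lossE2 xiE; apply: We.
by apply: (lt_le_trans ms); rewrite lerD2r -lee_fin utE.
Qed.

(** The inequality is strict at each [theta] where the coincidence event is not almost sure, so it
    serves both clauses of [pitman_nearer]. *)
Lemma GPN_gt_half d (Omega : measurableType d)
    (P : R * R -> probability Omega R) (X : Omega -> R * R) theta :
  measurable_fun [set: Omega] X -> has_location_density P X f ->
  Theta0 theta ->
  P theta [set w | l (diff12 (X w)) <= m01%:E <= u (diff12 (X w))] < 1 ->
  (2^-1)%:E < GPN P X W delta1 delta2 theta.
Proof.
move=> mX hXf htheta hP.
set lambda := (theta.2 - theta.1)%R.
have lambda0 : (0 <= lambda)%R by rewrite subr_ge0.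
pose K A t := density_on f lambda t (difference_slice theta A t).
(* [h] and [k] are the contributions of the slice at [t] to the GPN and to one half. *)
pose h t := K (better theta) t + (2^-1)%:E * K (tied theta) t.
pose k t := (2^-1)%:E * pdf_D f lambda t.
have half0 : 0 <= (2^-1)%:E :> \bar R by rewrite lee_fin invr_ge0.
have K0 A t : 0 <= K A t by exact: density_on_ge0.
have mK A : measurable A -> measurable_fun setT (K A).
  exact: measurable_density_slice.
have pdfE t : pdf_D f lambda t = K setT t.
  by rewrite -density_on_setT /K; congr density_on; apply/seteqP; split.
have mpdf : measurable_fun setT (pdf_D f lambda).
  by rewrite (_ : pdf_D f lambda = K setT); [exact: mK|exact/funext].
have pdf0 t : 0 <= pdf_D f lambda t by rewrite pdfE.
have h0 t : 0 <= h t by rewrite adde_ge0// mule_ge0.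
have k0 t : 0 <= k t by rewrite mule_ge0.
have mh : measurable_fun setT h.
  by apply: emeasurable_funD; [exact: mK|apply: measurable_funeM; exact: mK].
have mk : measurable_fun setT k by exact: measurable_funeM.
have ik : \int[mu]_t k t = (2^-1)%:E.
  by rewrite ge0_integralZl// integral_pdf_D_eq1// mule1.
have ih : GPN P X W delta1 delta2 theta = \int[mu]_t h t.
  rewrite ge0_integralD//; last 3 first.
  - exact: mK.
  - by move=> t _; rewrite mule_ge0.
  - by apply: measurable_funeM; exact: mK.
  rewrite ge0_integralZl//; last exact: mK.
  by rewrite /GPN -!(location_density_slices hf _ hXf htheta).
have outside t : support_D f lambda t -> ~ (l t <= m01%:E <= u t) -> k t < h t.
  move=> ht nlmu; apply: (lt_le_trans (better_outside lambda0 ht nlmu)).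
  by rewrite leeDl// mule_ge0.
have ipdf : mu.-integrable setT (pdf_D f lambda).
  apply/integrableP; split => //.
  by under eq_integral do rewrite gee0_abs//; rewrite integral_pdf_D_eq1// ltry.
have pdf_fin := integrable_ae measurableT ipdf.
have kh : {ae mu, forall t, k t <= h t}.
  apply: filterS pdf_fin => t /(_ I) pfin.
  have [lmu|nlmu] := boolP (l t <= m01%:E <= u t).
    (* The tie fills the whole slice, so its half weight is already [k t]. *)
    have -> : h t = K (better theta) t + k t.
      by rewrite /h {2}/K tied_within.
    by rewrite leeDr.
  (* Off the support the density of [D] is zero, where [k] vanishes, or infinite, which
     integrability confines to a null set. *)
  have [p0|p0] := eqVneq (pdf_D f lambda t) 0; first by rewrite /k p0 mule0.
  apply/ltW/outside; last exact/negP.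
  by rewrite /support_D /= lt0e p0 pdf0 -ge0_fin_numE.
rewrite ltNge; apply/negP; rewrite ih -ik => hk.
have kfin : \int[mu]_t k t < +oo by rewrite ik ltry.
have keqh := @ge0_ae_le_integral_eq _ _ _ mu k h mk mh k0 h0 kh kfin hk.
pose B := [set x : R * R | l (diff12 x) <= m01%:E <= u (diff12 x)].
have mB : measurable B.
  rewrite (_ : B = (setT `&` [set x | l (diff12 x) <= m01%:E]) `&`
      (setT `&` [set x | m01%:E <= u (diff12 x)])).
    apply: measurableI.
      by apply: emeasurable_fun_infty_c => //; exact: measurableT_comp.
    by apply: emeasurable_fun_c_infty => //; exact: measurableT_comp.
  by rewrite !setTI; apply/seteqP; split => x /= => [/andP//|[? ?]]; apply/andP.
have diffE s t : diff12 (s + theta.1, s + theta.1 + t)%R = t.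
  by rewrite /diff12 /= addrC addKr.
(* Once [k = h] almost everywhere, almost every slice of the complement of [B] has mass zero: it is
   empty, or the density of [D] vanishes, or [outside] contradicts the equality. *)
have PBC : P theta (X @^-1` (~` B)) = 0.
  rewrite (location_density_slices hf (measurableC mB) hXf htheta).
  rewrite (@ge0_ae_eq_integral _ _ _ mu setT _ (cst 0)) ?integral0//.
  - by apply: mK; exact: measurableC.
  - by move=> t _; exact: K0.
  apply: filterS2 keqh pdf_fin => t kht /(_ I) pfin _ /=.
  have [lmu|/negP nlmu] := boolP (l t <= m01%:E <= u t).
    rewrite (_ : difference_slice _ _ _ = set0) ?/density_on ?integral_set0//.
    by apply/seteqP; split => // s; rewrite /difference_slice /B /= diffE.
  have [p0|p0] := eqVneq (pdf_D f lambda t) 0.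
    apply/eqP; rewrite eq_le K0 andbT -p0 pdfE.
    apply: density_on_subset => //; apply: measurable_difference_slice => //.
    exact: measurableC.
  have : k t < h t.
    by apply: outside => //; rewrite /support_D /= lt0e p0 pdf0 -ge0_fin_numE.
  by rewrite kht ltxx.
have mXB : measurable (X @^-1` B).
  by rewrite -[X @^-1` B]setTI; exact: mX.
have := probability_setC (P theta) mXB.
rewrite preimage_setC PBC => /esym/eqP.
by rewrite gt_eqF// sube_gt0.
Qed.

End comparison.

Unset Implicit Arguments.

Theorem corollary3p1p2 (R : realType)
    (f : R * R -> R) (hf : is_pdf2 f)
    (d : measure_display) (Omega : measurableType d)
    (P : R * R -> probability Omega R)
    (X : Omega -> R * R) (hX : measurable_fun [set: Omega] X)
    (hXf : has_location_density P X f)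
    (W : R -> R) (hW : is_general_loss W)
    (hW0 : exists c : R, W x @[x --> (0 : R)%R^'] --> c)
    (m01 : R) (hm01 : is_median (pdf_Z1 f) m01)
    (m1 : R -> R -> R)
    (hm1 : forall lambda t : R, (0 <= lambda)%R -> support_D f lambda t ->
       unique (is_median (cond_pdf_Z1 f lambda t)) (m1 lambda t))
    (l u : R -> \bar R)
    (hl : measurable_fun [set: R] l) (hu : measurable_fun [set: R] u)
    (hlu : forall lambda t : R, (0 <= lambda)%R -> support_D f lambda t ->
       l t <= (m1 lambda t)%:E <= u t)
    (hP : forall theta : R * R, Theta0 theta ->
       P theta [set w | l (diff12 (X w)) <= m01%:E <= u (diff12 (X w))] < 1) :
  pitman_nearer P X W (delta_xi (xi_star l u m01)) (delta_PNLEE m01).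
Proof.
split => [theta htheta|].
  apply/ltW; apply: (GPN_gt_half hf hW hW0 hm1 hl hu hlu hX hXf htheta).
  exact: hP.
(* Any point of [Theta0] would do, the inequality being strict throughout. *)
exists (0, 0)%R; first by rewrite /Theta0 /=.
by apply: (GPN_gt_half hf hW hW0 hm1 hl hu hlu hX hXf) => //;
  [rewrite /Theta0 /=|apply: hP; rewrite /Theta0 /=].
Qed.
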